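(* Let $T=T_s$ be a tent map with slope $s\in(\sqrt2,2)$, critical point $c=\frac12$ and kneading map $Q$. If $Q(k)$ is bounded and $c$ is infinitely recurrent (recurrent and not periodic), then $\mathcal F\ne\mathcal E$, where $\mathcal F$ and $\mathcal E$ are the sets of folding points and endpoints of $\varprojlim\{[c_2,c_1],T|_{[c_2,c_1]}\}$.
   Context: $T_s(x)=\min\{sx,s(1-x)\}$ on $[0,1]$; $c_k=T^k(c)$. Recurrent means $c\in\omega(c)$. $\mathcal K(T)=e_1e_2\cdots$ with $e_i=1$ if $c_i>c$ and $e_i=0$ if $c_i<c$. Cutting times: $S_0=1$, $S_{k+1}=S_k+\min\{j\ge1:e_{S_k+j}\ne e_j\}$; the kneading map $Q$ is defined by $S_k-S_{k-1}=S_{Q(k)}$ for $k\ge1$. The core inverse limit space is $\{(\dots,x_{-2},x_{-1},x_0): x_{-i}\in[c_2,c_1],\ T(x_{-i})=x_{-(i-1)},\ i\in\mathbb N\}$ with the product metric. A point $x$ of it is a folding point if it has no neighbourhood homeomorphic to the product of a Cantor set and an open interval; equivalently $x_{-m}\in\omega(c)$ for all $m\ge0$. A point $x$ is an endpoint if for any two subcontinua $A,B$ containing $x$, either $A\subset B$ or $B\subset A$. *)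

(* Defs.v *)
From HB Require Import structures.
From mathcomp Require Import all_boot all_order all_algebra.
From mathcomp Require Import all_classical all_reals all_analysis.

Set Implicit Arguments.
Unset Strict Implicit.
Unset Printing Implicit Defensive.

Import Order.TTheory GRing.Theory Num.Theory.
Import numFieldNormedType.Exports.

Local Open Scope classical_set_scope.
Local Open Scope ring_scope.

Section Topology.
Variables X Y : topologicalType.

(* [f] and [g] are total functions, only their values on [A] and [B] matter;
   [{within A, continuous f}] is continuity for the subspace topology. *)
Definition homeomorphic (A : set X) (B : set Y) : Prop :=
  exists (f : X -> Y) (g : Y -> X),
    [/\ set_bij A B f, {in A, cancel f g},
        {within A, continuous f} & {within B, continuous g}].

Definition subcontinuum (X0 A : set X) : Prop :=
  [/\ A `<=` X0, A !=set0, compact A & connected A].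

Definition endpoints (X0 : set X) : set X :=
  [set x | X0 x /\
    forall A B : set X, subcontinuum X0 A -> subcontinuum X0 B ->
      A x -> B x -> A `<=` B \/ B `<=` A].

End Topology.

(* Neighbourhoods are relative to [X0]; they need not be open. *)
Definition folding_points (R : realType) (X : topologicalType) (X0 : set X) :
    set X :=
  [set x | X0 x /\
    ~ exists N : set X,
        [/\ N `<=` X0, within X0 (nbhs x) N &
            homeomorphic N ([set: cantor_space] `*` (`]0, 1[%classic : set R))]].

(* Real sequences with the product topology. *)
Definition seq_space (R : realType) : topologicalType :=
  prod_topology (fun _ : nat => (R : topologicalType)).

Section Tent.
Variables (R : realType) (s : R).

Definition tent (x : R) : R := Num.min (s * x) (s * (1 - x)).

Definition crit : R := 2^-1.

Definition crit_orbit (k : nat) : R := iter k tent crit.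

Definition omega_crit : set R := cluster (crit_orbit @ \oo).

Definition recurrent_crit : Prop := omega_crit crit.

Definition periodic_crit : Prop :=
  exists n : nat, (0 < n)%N /\ crit_orbit n = crit.

(* Indices start at 1.  The value [true] stands for the digit 1.  The case
   [crit_orbit i = crit], where the digit is undefined, occurs for some [i >= 1]
   exactly when [crit] is periodic. *)
Definition kneading_seq (i : nat) : bool := crit < crit_orbit i.

(* A cutting time S_{k+1} exists as soon as the sequence shifted by S_k differs
   from the sequence itself, which holds when [crit] is not periodic (and [s] is
   as in the theorem); [S] is then determined by this property. *)
Definition cutting_times (S : nat -> nat) : Prop :=
  S 0%N = 1%N /\
  forall k : nat, exists j : nat,
    [/\ (1 <= j)%N,
        kneading_seq (S k + j)%N != kneading_seq j,
        forall i : nat, (1 <= i < j)%N ->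
          kneading_seq (S k + i)%N = kneading_seq i &
        S k.+1 = (S k + j)%N].

(* The value [Q 0] is irrelevant; [Q k] is unique for [k >= 1] because [S] is
   strictly increasing. *)
Definition kneading_map (Q : nat -> nat) : Prop :=
  exists2 S : nat -> nat, cutting_times S &
    forall k : nat, (1 <= k)%N -> (S k - S k.-1)%N = S (Q k).

(* The coordinate x_{-i} is [x i]. *)
Definition core_inverse_limit : set (seq_space R) :=
  [set x | forall i : nat,
     x i \in `[crit_orbit 2, crit_orbit 1] /\ tent (x i.+1) = x i].

End Tent.

(* Main.v *)
Require Import Defs.
From mathcomp Require Import all_boot all_order all_algebra.
From mathcomp Require Import all_classical all_reals all_analysis.
From mathcomp Require Import zify ring lra.

(* Let [c] denote the critical point and [c_k] its images.  An image
   [T^j [c, c + w]] can first contain [c] in its interior only when [j] is a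
   cutting time [S_k].  If [Q] is bounded then so are the gaps between cutting
   times, which keeps all [c_(S_k)] away from [c]; hence [T^j] is affine on
   [[c, c + w]] as soon as [s^j w <= d], for some [d > 0] independent of [j].

   By recurrence some [c_n], [n > 0], has arbitrarily small distance [a > 0] to
   [c]; choose [i] with [s^i a] of the order of [d].  Then [T^i] is affine on
   [[c, c + 2 a]], so [c_(n + i)] is the middle of a monotone branch of uniform
   length.  A limit, along an ultrafilter, of the histories
   [(..., c_(n + i - 1), c_(n + i))] is therefore interior to an arc, so it is
   not an endpoint.  It is a folding point because arcs folded at histories of
   [c] itself, of uniform size by the same affineness, accumulate at it. *)

Set Implicit Arguments.
Unset Strict Implicit.
Unset Printing Implicit Defensive.

Import Order.TTheory GRing.Theory Num.Theory.
Import numFieldNormedType.Exports.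

Local Open Scope classical_set_scope.
Local Open Scope ring_scope.

(** * Affine branches of iterates of the tent map at the critical point *)

Section TentMap.
Variables (R : realType) (s : R).
Hypotheses (s1 : 1 < s) (s2 : s < 2).

Local Notation T := (tent s).
Local Notation c := (crit R).
Local Notation co := (crit_orbit s).

Let s0 : 0 < s. Proof. by apply: lt_trans s1. Qed.

Let sX0 n : 0 < s ^+ n. Proof. by rewrite exprn_gt0. Qed.

Lemma tent_crit u : T (c + u) = s / 2 - s * `|u|.
Proof.
have s0' := s0; rewrite /tent /crit minEle.
by case: ifP => h; case: (ger0P u) => hu; nra.
Qed.

Lemma tentE x : T x = s / 2 - s * `|x - c|.
Proof. by rewrite -tent_crit addrC subrK. Qed.

Lemma tent_dist x y : `|T x - T y| <= s * `|x - y|.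
Proof.
rewrite !tentE.
have -> : s / 2 - s * `|x - c| - (s / 2 - s * `|y - c|)
  = s * (`|y - c| - `|x - c|) by ring.
rewrite normrM (gtr0_norm s0); apply: ler_wpM2l; first exact: ltW.
have := ler_dist_dist (y - c) (x - c).
by rewrite (_ : y - c - (x - c) = y - x) ?(distrC y x) //; ring.
Qed.

Lemma iter_tent_dist n x y :
  `|iter n T x - iter n T y| <= s ^+ n * `|x - y|.
Proof.
elim: n => [|n IHn]; first by rewrite expr0 mul1r.
apply: le_trans (tent_dist _ _) _.
by rewrite exprS -mulrA; apply: ler_wpM2l; first exact: ltW.
Qed.

Lemma iter_tentN n u : (0 < n)%N -> iter n T (c - u) = iter n T (c + u).
Proof. by case: n => // n _; rewrite !iterSr !tent_crit normrN. Qed.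

Lemma crit_orbitD m n : iter m T (co n) = co (m + n).
Proof. by rewrite /crit_orbit iterD. Qed.

(* No image [T^i [c, c + w]], [1 <= i < j], has [c] in its interior. *)
Definition unfolded (j : nat) (w : R) : Prop :=
  forall i, (0 < i < j)%N -> 0 <= (co i - c) * (iter i T (c + w) - c).

(** If [T^j] is affine on [[c, c + w]], then its image is the interval between [c_j] and
    [T^j (c + w)]. As both ends lie on one side of [c], one more [T] only multiplies the slope by
    [s] or [- s]. *)
Lemma unfolded_affine j w : (0 < j)%N -> unfolded j w ->
  exists2 g : R, g = 1 \/ g = -1 &
    forall u, 0 <= u <= w -> iter j T (c + u) = co j + g * s ^+ j * u.
Proof.
case: j => // j _; elim: j => [|j IHj] unf.
  exists (-1); first by right.
  move=> u /andP[u0 _]; rewrite /crit_orbit /= -{2}[c]addr0 !tent_crit.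
  by rewrite normr0 ger0_norm // expr1; ring.
have [i /andP[i0 ij]|g gE gP] := IHj; first by apply: unf; rewrite i0 ltnW.
have [w0|w0] := leP 0 w; last first.
  exists 1; first by left.
  by move=> u /andP[u0 uw]; lra.
have := unf j.+1; rewrite ltnS leqnn => /(_ isT).
have -> := gP w; last by rewrite w0 lexx.
move=> side.
have TE u : 0 <= u <= w ->
    iter j.+2 T (c + u) = s / 2 - s * `|co j.+1 + g * s ^+ j.+1 * u - c|.
  by move=> uw; rewrite iterS gP // tentE.
have coE : co j.+2 = s / 2 - s * `|co j.+1 - c|.
  by rewrite /crit_orbit iterS tentE.
have sj := sX0 j.+1.
move: gE side TE coE; set p := co j.+1; set S := s ^+ j.+1.
rewrite -/S in sj * => gE side TE ->.
have wS : 0 <= S * w by rewrite mulr_ge0 // ltW.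
have between u : 0 <= u <= w -> 0 <= S * u <= S * w.
  by move=> /andP[u0 uw]; rewrite !ler_wpM2l ?(ltW sj) // mulr_ge0 // ltW.
(* If [p = c], the product carries no information and the other end decides the side. *)
have [p0|p0] : (0 <= p - c /\ 0 <= p + g * S * w - c) \/
    (p - c <= 0 /\ p + g * S * w - c <= 0).
  move: side; set q := p + _ - c.
  case: (ltrgt0P (p - c)) => hp hq.
  - by left; rewrite -(pmulr_rge0 _ hp); split => //; exact: ltW.
  - by right; rewrite -(nmulr_rge0 _ hp); split => //; exact: ltW.
  - by case: (leP 0 q) => h; [left|right]; split => //; exact: ltW.
- exists (- g); first by case: gE => ->; [right|left; rewrite opprK].
  move=> u uw; rewrite TE // !ger0_norm; [by rewrite exprS -/S; ring| |].
  + by case: p0.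
  + have := between _ uw; case: p0; rewrite -!mulrA.
    by case: gE => ->; rewrite ?mul1r ?mulN1r; lra.
- exists g => //.
  move=> u uw; rewrite TE // !ler0_norm; [by rewrite exprS -/S; ring| |].
  + by case: p0.
  + have := between _ uw; case: p0; rewrite -!mulrA.
    by case: gE => ->; rewrite ?mul1r ?mulN1r; lra.
Qed.

Lemma unfolded_dist j w u v : (0 < j)%N -> unfolded j w ->
  0 <= u <= w -> 0 <= v <= w ->
  `|iter j T (c + u) - iter j T (c + v)| = s ^+ j * `|u - v|.
Proof.
move=> j0 unf uw vw; have [g gE gP] := unfolded_affine j0 unf.
rewrite !gP //.
have -> : co j + g * s ^+ j * u - (co j + g * s ^+ j * v) =
   g * (s ^+ j * (u - v)) by ring.
rewrite !normrM (gtr0_norm (sX0 j)); case: gE => ->;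
  by rewrite ?normrN normr1 mul1r.
Qed.

End TentMap.

Lemma ratio_itv01 (R : realFieldType) (v w : R) :
  0 < w -> 0 <= v <= w -> 0 <= v / w <= 1.
Proof.
move=> w0 /andP[v0 vw].
by rewrite ler_pdivrMr // mul1r vw andbT divr_ge0 // ltW.
Qed.

(** * Cutting times as the orders of closest precritical points *)

Section CuttingTimes.
Variables (R : realType) (s : R).
Hypotheses (s1 : 1 < s) (s2 : s < 2).

Local Notation T := (tent s).
Local Notation c := (crit R).
Local Notation co := (crit_orbit s).
Local Notation unfolded := (unfolded s).

Let s0 : 0 < s. Proof. by apply: lt_trans s1. Qed.

Let sX0 n : 0 < s ^+ n. Proof. by rewrite exprn_gt0. Qed.

Lemma unfolded_convex j w l : (0 < j)%N -> unfolded j w -> 0 <= w ->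
  0 <= l <= 1 ->
  iter j T (c + l * w) = co j + l * (iter j T (c + w) - co j).
Proof.
move=> j0 unf w0 /andP[l0 l1]; have [g _ gP] := unfolded_affine s1 j0 unf.
rewrite gP ?mulr_ge0 ?ler_piMl // gP ?w0 ?lexx //; ring.
Qed.

Lemma unfoldedS i j w : (i <= j)%N -> unfolded j w -> unfolded i w.
Proof.
move=> ij unf k /andP[k0 ki]; apply: unf.
by rewrite k0 (leq_trans ki).
Qed.

Lemma unfoldedW j v w : 0 <= v <= w -> unfolded j w -> unfolded j v.
Proof.
move=> /andP[v0 vw] unf i /[dup] /andP[i0 ij] iP.
have [w0|w0] := eqVneq w 0.
  have -> : v = w by apply/eqP; rewrite eq_le vw w0 v0.
  exact: unf.
have wgt0 : 0 < w by rewrite lt_neqAle eq_sym w0 (le_trans v0).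
have -> : v = v / w * w by rewrite divfK.
have l01 := ratio_itv01 wgt0 (introT andP (conj v0 vw)).
rewrite unfolded_convex ?(ltW wgt0) //; last exact: unfoldedS (ltnW ij) unf.
move: (unf _ iP) l01.
move: (v / w) (co i) (iter i T _) => l a b ab /andP[l0 l1].
(* The product for [v] is a convex combination of a square and of the product for [w]. *)
have -> : (a - c) * (a + l * (b - a) - c) =
  (1 - l) * (a - c) ^+ 2 + l * ((a - c) * (b - c)) by ring.
by rewrite addr_ge0 // mulr_ge0 ?sqr_ge0 // subr_ge0.
Qed.

(** The point [c + z] is known as a closest precritical point of order [j]. For non-periodic [c],
    the orders that occur are exactly the cutting times. *)
Definition precritical_time (j : nat) : Prop :=
  exists z, [/\ 0 < z, unfolded j z & iter j T (c + z) = c].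

Lemma crossing_precritical j w : (0 < j)%N -> unfolded j w -> 0 < w ->
  (co j - c) * (iter j T (c + w) - c) < 0 -> precritical_time j.
Proof.
move=> j0 unf w0 ab.
set a := co j - c in ab; set b := iter j T (c + w) - c in ab.
have abN : a - b != 0.
  apply: contraTneq ab => /eqP; rewrite subr_eq0 => /eqP ->.
  by rewrite -leNgt -expr2 sqr_ge0.
have aN : a != 0 by apply: contraTneq ab => ->; rewrite mul0r ltxx.
(* The affine map from [a] to [b] vanishes at the parameter [a / (a - b)]. *)
have l01 : 0 < a / (a - b) < 1.
  have a20 : 0 < a ^+ 2 by rewrite exprn_even_gt0.
  have ab20 : 0 < (a - b) ^+ 2 by rewrite exprn_even_gt0.
  have bN : b != 0 by apply: contraTneq ab => ->; rewrite mulr0 ltxx.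
  have b20 : 0 < b ^+ 2 by rewrite exprn_even_gt0.
  have -> : a / (a - b) = (a ^+ 2 - a * b) / (a - b) ^+ 2 by field.
  rewrite divr_gt0 ?ltr_pdivrMr //=; last by lra.
  have -> : (a - b) ^+ 2 = a ^+ 2 - 2 * (a * b) + b ^+ 2 by ring.
  lra.
move: l01 => /andP[l0 l1].
exists (a / (a - b) * w); split; first exact: mulr_gt0.
  apply: unfoldedW unf; apply/andP; split; first by rewrite mulr_ge0 // ltW.
  by rewrite ler_piMl // ltW.
rewrite unfolded_convex ?(ltW w0) ?(ltW l0) ?(ltW l1) //.
have -> : co j = a + c by rewrite subrK.
have -> : iter j T (c + w) = b + c by rewrite subrK.
by field.
Qed.

Section KneadingMap.
Variable S : nat -> nat.
Hypotheses (cutS : cutting_times s S) (nper : ~ periodic_crit s).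

Let S0 : S 0%N = 1%N. Proof. by case: cutS. Qed.

(** No [c_i] with [i > 0] equals [c], so digits agree or differ according to the sign of a
    product. *)
Lemma cutting_timesP k : exists t, [/\ (0 < t)%N, S k.+1 = (S k + t)%N,
    (co (S k + t)%N - c) * (co t - c) < 0 &
    forall i, (0 < i < t)%N -> 0 < (co (S k + i)%N - c) * (co i - c)].
Proof.
have coN i : (0 < i)%N -> co i - c != 0.
  by move=> i0; rewrite subr_eq0; apply/eqP => h; apply: nper; exists i.
have [_ /(_ k)[t [t0 neq eq SE]]] := cutS.
exists t; split => //.
- move: neq; rewrite /kneading_seq -![c < _]subr_gt0.
  have := coN t t0; have := coN (S k + t)%N (ltn_addl _ t0).
  case: (ltrgt0P (co t - c)) => //; case: (ltrgt0P (co (S k + t)%N - c)) => //.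
    by move=> a b _ _ _; rewrite nmulr_rlt0.
  by move=> a b _ _ _; rewrite pmulr_rlt0.
- move=> i it; have i0 : (0 < i)%N by case/andP: it.
  have := eq i it; rewrite /kneading_seq -![c < _]subr_gt0.
  have := coN i i0; have := coN (S k + i)%N (ltn_addl _ i0).
  case: (ltrgt0P (co i - c)) => //; case: (ltrgt0P (co (S k + i)%N - c)) => //.
    by move=> a b _ _ _; rewrite pmulr_rgt0.
  by move=> a b _ _ _; rewrite nmulr_rgt0.
Qed.

Let Sgt0 k : (0 < S k)%N.
Proof.
elim: k => [|k IHk]; first by rewrite S0.
by have [t [_ -> _ _]] := cutting_timesP k; rewrite addn_gt0 IHk.
Qed.

(** From time [S k] on, the orbit of [c + z] is that of [c] delayed by [S k]. The ends of the image
    at time [S k + i] are thus [c_(S_k + i)] and [c_i]. *)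
Lemma unfolded_past_cutting k z j t : unfolded (S k) z ->
  iter (S k) T (c + z) = c ->
  (forall i, (0 < i < t)%N -> 0 < (co (S k + i)%N - c) * (co i - c)) ->
  (j <= S k + t)%N -> unfolded j z.
Proof.
move=> unf zc eq jt i /andP[i0 ij].
case: (ltngtP i (S k)) => h.
- by apply: unf; rewrite i0.
- have -> : i = (S k + (i - S k))%N by lia.
  rewrite [X in iter X]addnC iterD zc ltW //; apply: eq; lia.
- by rewrite h zc subrr mulr0.
Qed.

(** By induction: at time [S k.+1 = S k + t] the interval that was precritical at time [S k] has
    image with ends [c_(S_k + t)] and [c_t]. These lie on opposite sides of [c], so [c] is attained
    in between. *)
Lemma cutting_precritical k : precritical_time (S k).
Proof.
elim: k => [|k [z [z0 unf zc]]].
  (* The solution of [s / 2 - s * z = 1 / 2]. *)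
  exists ((s - 1) / (2 * s)); have sN : s != 0 by rewrite gt_eqF.
  have z0 : 0 < (s - 1) / (2 * s).
    by rewrite divr_gt0 ?subr_gt0 // mulr_gt0.
  split => //; rewrite S0; first by case.
  by rewrite /= tent_crit // gtr0_norm // /crit; field.
have [t [t0 SE neq eq]] := cutting_timesP k.
rewrite SE; apply: (@crossing_precritical _ z) => //.
- by rewrite addn_gt0 Sgt0.
- exact: unfolded_past_cutting eq (leqnn _).
- by rewrite [X in iter X]addnC iterD zc.
Qed.

Lemma cutting_bracket j : (0 < j)%N -> exists k, (S k <= j < S k.+1)%N.
Proof.
elim: j => // -[_ _|j /(_ isT)[k kP] _].
  exists 0%N; rewrite S0 /=.
  by have [t [t0 -> _ _]] := cutting_timesP 0; rewrite S0; lia.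
have [lt|ge] := ltnP j.+2 (S k.+1); first by exists k; lia.
exists k.+1; have [t [t0 -> _ _]] := cutting_timesP k.+1; lia.
Qed.

(** Suppose [S k < j < S k.+1], and let [y] and [z] be the precritical parameters of [j] and [S k].
    If [z < y], then [[c, c + y]] is already folded at time [S k]. If [y <= z], then [T^j
    [c, c + z]] has its ends [c_j] and [c_(j - S_k)] strictly on one side of [c], so it cannot
    contain [T^j (c + y) = c]. *)
Lemma precritical_cutting j : (0 < j)%N -> precritical_time j ->
  exists k, j = S k.
Proof.
move=> j0 [y [y0 unfy yc]]; have [k /andP[Sj jS]] := cutting_bracket j0.
exists k; apply/eqP/contraT => jN.
have {jN}Sj : (S k < j)%N by rewrite ltn_neqAle eq_sym jN.
have [z [z0 unfz zc]] := cutting_precritical k.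
have coN i : (0 < i)%N -> co i - c != 0.
  by move=> i0; rewrite subr_eq0; apply/eqP => h; apply: nper; exists i.
have [t [t0 SE _ eq]] := cutting_timesP k.
(* An interval with ends [a != c] and [b] on one side of [c] can contain [c] only as its end [b]. *)
have contra l a b : 0 <= l <= 1 -> a + l * (b - a) = c -> a - c != 0 ->
    0 <= (a - c) * (b - c) -> l < 1 \/ 0 < (a - c) * (b - c) -> False.
  move=> /andP[l0 l1] lE aN ab h.
  have a20 : 0 < (a - c) ^+ 2 by rewrite exprn_even_gt0.
  suff : 0 < (1 - l) * (a - c) ^+ 2 + l * ((a - c) * (b - c)).
    have -> : (1 - l) * (a - c) ^+ 2 + l * ((a - c) * (b - c)) =
      (a - c) * (a + l * (b - a) - c) by ring.
    by rewrite lE subrr mulr0 ltxx.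
  have [l1'|l1'] := ltP l 1.
    by apply: ltr_wpDr; [exact: mulr_ge0 | rewrite mulr_gt0 // subr_gt0].
  have lE1 : l = 1 by apply/eqP; rewrite eq_le l1.
  by case: h; rewrite lE1 ?ltxx // subrr mul0r add0r mul1r.
have [zy|yz] := ltP z y.
- have l01 : 0 <= z / y <= 1 by apply: ratio_itv01; rewrite ?(ltW z0) ?(ltW zy).
  apply: False_ind; apply: (contra (z / y) (co (S k)) (iter (S k) T (c + y))).
  + exact: l01.
  + rewrite -unfolded_convex ?(ltW y0) //; first by rewrite divfK ?gt_eqF.
    exact: unfoldedS (ltnW Sj) unfy.
  + exact: coN.
  + by apply: unfy; rewrite Sgt0.
  + by left; rewrite ltr_pdivrMr // mul1r.
- have unf : unfolded j z by apply: unfolded_past_cutting eq _ => //; lia.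
  have E : iter j T (c + z) = co (j - S k)%N.
    by rewrite -{1}(subnK (ltnW Sj)) iterD zc.
  have pos : 0 < (co j - c) * (co (j - S k)%N - c).
    rewrite -{1}(subnKC (ltnW Sj)); apply: eq; lia.
  have l01 : 0 <= y / z <= 1 by apply: ratio_itv01; rewrite ?(ltW y0).
  apply: False_ind; apply: (contra (y / z) (co j) (iter j T (c + z))).
  + exact: l01.
  + by rewrite -unfolded_convex ?(ltW z0) // divfK ?gt_eqF.
  + exact: coN.
  + by rewrite E ltW.
  + by right; rewrite E.
Qed.

Lemma crit_orbit_far M : exists2 m : R, 0 < m &
  forall i, (0 < i <= M)%N -> m <= `|co i - c|.
Proof.
elim: M => [|M [m m0 mP]]; first by exists 1 => // i; lia.
have coN : co M.+1 - c != 0.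
  by rewrite subr_eq0; apply/eqP => h; apply: nper; exists M.+1.
exists (Num.min m `|co M.+1 - c|); first by rewrite lt_min m0 normr_gt0.
move=> i /andP[i0]; rewrite leq_eqVlt => /orP[/eqP ->|iM].
  by rewrite ge_min lexx orbT.
by rewrite ge_min mP // i0.
Qed.

(* If [c_(S_k)] were close to [c], then [c_(S_k + i)] and [c_i] would lie on
   the same side of [c] for long, so that [S_(k+1) - S_k] would be large. *)
Lemma cutting_times_far M : (forall k, (S k.+1 <= S k + M)%N) ->
  exists2 d : R, 0 < d & forall k, d <= `|co (S k) - c|.
Proof.
move=> SM; have [m m0 mP] := crit_orbit_far M.
(* Here [m] bounds the distance of [c_1, ..., c_M] to [c] from below. If [c_(S_k)] is closer to [c]
   than [m / s^M], then after [t <= M] steps the distance between [c_(S_k + t)] and [c_t] is below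
   [m], too small for opposite sides of [c]. *)
exists (m / s ^+ M); first by rewrite divr_gt0.
move=> k; rewrite leNgt; apply/negP; rewrite ltr_pdivlMr // => close.
have [t [t0 SE neq _]] := cutting_timesP k.
have tM : (t <= M)%N by have := SM k; rewrite SE leq_add2l.
have := iter_tent_dist s1 t (co (S k)) c.
rewrite crit_orbitD addnC -/(co t).
have : s ^+ t * `|co (S k) - c| < m.
  apply: le_lt_trans close; rewrite mulrC ler_wpM2l // ler_eXn2l //.
have := mP t; rewrite t0 tM => /(_ isT).
move: neq.
move: (co (S k + t)%N) (co t) (`|co (S k) - c|) => a b d ab mb dm abd.
have : `|a - b| < `|b - c| by apply: le_lt_trans abd (lt_le_trans dm mb).
rewrite -ltr_sqr ?nnegrE // !real_normK ?num_real // ltNge => /negP; apply.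
have a2 := sqr_ge0 (a - c).
have -> : (a - b) ^+ 2 = (a - c) ^+ 2 - 2 * ((a - c) * (b - c)) + (b - c) ^+ 2.
  by ring.
lra.
Qed.

End KneadingMap.

(** The first time [i] at which [c] falls strictly inside the image is a cutting time, so [c_i] has
    distance at least [d] from [c]. But the image has length [s^i w <= d], too short to reach beyond
    [c]. *)
Lemma unfolded_small Q : kneading_map s Q ->
  (exists B : nat, forall k : nat, (1 <= k)%N -> (Q k <= B)%N) ->
  ~ periodic_crit s ->
  exists2 d : R, 0 < d & forall j w, 0 <= w -> s ^+ j * w <= d -> unfolded j w.
Proof.
move=> [S cutS QP] [B QB] nper.
have Smono i j : (i <= j)%N -> (S i <= S j)%N.
  elim: j => [|j IHj]; first by rewrite leqn0 => /eqP ->.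
  rewrite leq_eqVlt => /orP[/eqP -> //|ij].
  have [t [_ -> _ _]] := cutting_timesP cutS nper j.
  by rewrite ltnS in ij; have := IHj ij; lia.
(* The gap [S k.+1 - S k] is [S (Q k.+1)], and [S] is monotone. *)
have SM k : (S k.+1 <= S k + S B)%N.
  have := QP k.+1 isT; have := Smono _ _ (QB k.+1 isT); rewrite /=; lia.
have [d d0 dP] := cutting_times_far cutS nper SM.
exists d => // j w w0 sw.
suff : forall i, (i <= j)%N -> unfolded i w by apply.
elim=> [|i IHi] ij; first by move=> ?; lia.
have unf := IHi (ltnW ij).
move=> k /andP[k0]; rewrite ltnS leq_eqVlt => /orP[/eqP kE|ki]; last first.
  by apply: unf; rewrite k0.
rewrite {k}kE in k0 *.
rewrite leNgt; apply/negP => cross.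
have w0' : 0 < w.
  rewrite lt_neqAle w0 andbT; apply/eqP => w0'; move: cross.
  by rewrite -w0' addr0 -/(co i) -expr2 ltNge sqr_ge0.
have [k iE] := precritical_cutting cutS nper k0
  (crossing_precritical k0 unf w0' cross).
have := unfolded_dist s1 (u := 0) (v := w) k0 unf.
rewrite !lexx w0 => /(_ isT isT).
rewrite addr0 -/(co i) sub0r normrN (ger0_norm w0).
have si : s ^+ i * w <= d.
  by apply: le_trans sw; rewrite ler_wpM2r // ler_eXn2l // ltnW.
have := dP k; rewrite -iE => h1 h2.
have : `|co i - iter i T (c + w)| <= `|co i - c|.
  by rewrite h2; apply: le_trans si h1.
rewrite -ler_sqr ?nnegrE // !real_normK ?num_real // leNgt => /negP; apply.
move: cross; move: (co i) (iter i T _) => a b ab.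
have -> : (a - b) ^+ 2 = (a - c) ^+ 2 - 2 * ((a - c) * (b - c)) + (b - c) ^+ 2.
  by ring.
have := sqr_ge0 (b - c); lra.
Qed.

End CuttingTimes.

(** * Convergence in the product topology and along ultrafilters *)

Section SequenceTopology.

Lemma prod_cvgP (K : nat -> topologicalType) (F : set_system (prod_topology K))
    (x : prod_topology K) {FF : Filter F} :
  (forall j, (fun y : prod_topology K => y j) @ F --> x j) -> F --> x.
Proof.
move=> Fx; apply/cvg_sup => i A [_ [[B oB <-] Bx BA]].
rewrite nbhs_simpl; apply: filterS BA _; apply: (Fx i).
exact: open_nbhs_nbhs.
Qed.

Lemma coordinate_cvg (K : nat -> topologicalType) (L : Type)
    (F : set_system L) (p : L -> prod_topology K) (x : prod_topology K) j
    {FF : Filter F} : p @ F --> x -> (fun l => p l j) @ F --> x j.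
Proof.
by move=> px; exact: (cvg_comp _ _ px (@proj_continuous nat K j x)).
Qed.

Lemma cvg_near_eq (X : topologicalType) (L : Type) (F : set_system L)
    (p q : L -> X) (x : X) {FF : Filter F} :
  (\forall l \near F, p l = q l) -> p @ F --> x -> q @ F --> x.
Proof.
move=> pq px A xA; change (F (q @^-1` A)).
by apply: filterS2 pq (px A xA) => l /= ->.
Qed.

Lemma near_leq (L : Type) (F : set_system L) (P : nat -> L -> Prop) (k : nat)
    {FF : Filter F} : (forall j, \forall l \near F, P j l) ->
  \forall l \near F, forall j, (j <= k)%N -> P j l.
Proof.
move=> FP; elim: k => [|k IHk].
  by apply: filterS (FP 0%N) => l ? j; rewrite leqn0 => /eqP ->.
apply: filterS2 IHk (FP k.+1) => l Pk PSk j.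
by rewrite leq_eqVlt => /orP[/eqP -> //|]; exact: Pk.
Qed.

(** The sets that contain such a box form a filter converging to [x] in each coordinate, so this
    filter contains every neighbourhood of [x]. *)
Lemma nbhs_seq_space (R : realType) (x : seq_space R) (A : set (seq_space R)) :
  nbhs x A -> exists k, exists2 e : R, 0 < e &
    forall y : seq_space R, (forall j, (j <= k)%N -> `|y j - x j| < e) -> A y.
Proof.
pose G : set_system (seq_space R) := [set B | exists k, exists2 e : R, 0 < e &
    forall y : seq_space R, (forall j, (j <= k)%N -> `|y j - x j| < e) -> B y].
have GF : Filter G.
  split.
  - by exists 0%N, 1.
  - move=> B C [k [e e0 kB]] [k' [e' e'0 kC]].
    exists (maxn k k'), (Num.min e e'); first by rewrite lt_min e0.
    move=> y yP; split; [apply: kB|apply: kC] => j jk;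
      have := yP j; rewrite leq_max jk ?orbT => /(_ isT);
      by rewrite lt_min => /andP[].
  - by move=> B C BC [k [e e0 kB]]; exists k, e => // y /kB /BC.
suff : G --> x by apply.
apply: prod_cvgP => j B /nbhs_ballP[e e0 eB].
by exists j, e => // y yP; apply: eB; rewrite /= /ball /= distrC; exact: yP.
Qed.

Lemma within_cvg (X Y : topologicalType) (A : set X) (f : X -> Y) (L : Type)
    (F : set_system L) (p : L -> X) (x : X) {FF : Filter F} :
  {within A, continuous f} -> A x -> (\forall l \near F, A (p l)) ->
  p @ F --> x -> (f \o p) @ F --> f x.
Proof.
move=> /subspace_continuousP cf Ax Ap px B fB.
have := px _ (cf x Ax B fB); rewrite /= !nbhs_simpl /= => pB.
by apply: filterS2 Ap pB => l Al; exact.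
Qed.

(** Compactness gives a cluster point, and an ultrafilter converges to each of its cluster points.
    This takes the place of extracting subsequences. *)
Lemma ultra_cvg (X : topologicalType) (K : set X) (L : Type)
    (F : set_system L) (p : L -> X) {FU : UltraFilter F} :
  compact K -> (forall l, K (p l)) -> exists2 x, K x & p @ F --> x.
Proof.
move=> cK Kp; have [x [Kx xF]] : K `&` cluster (p @ F) !=set0.
  by apply: (cK (p @ F)); change (F (p @^-1` K)); exact: filterE.
exists x => // A xA; rewrite nbhs_simpl.
have [//|FnA] := in_ultra_setVsetC (p @^-1` A) FU.
have [y [nA Ay]] := xF (~` A) A FnA xA.
by case: nA.
Qed.

End SequenceTopology.

(** * The core inverse limit: points with a prescribed coordinate, and compactness *)

Section InverseLimit.
Variables (R : realType) (s : R).
Hypotheses (s1 : 1 < s) (s2 : s < 2).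

Local Notation T := (tent s).
Local Notation c := (crit R).
Local Notation co := (crit_orbit s).
Local Notation X0 := (core_inverse_limit s).

Let s0 : 0 < s. Proof. by apply: lt_trans s1. Qed.

Let sX0 n : 0 < s ^+ n. Proof. by rewrite exprn_gt0. Qed.

Definition core : set R := `[co 2, co 1].

Lemma coreE x : core x <-> s * (1 - s / 2) <= x <= s / 2.
Proof.
have c1 : co 1%N = s / 2 by rewrite /crit_orbit /= tentE // subrr normr0; ring.
have c2 : co 2%N = s * (1 - s / 2).
  have -> : co 2%N = T (co 1%N) by [].
  rewrite c1 tentE // /crit ger0_norm; first by field.
  by have := s1; lra.
by rewrite /core c1 c2 /= in_itv.
Qed.

(** The bound is [c - c_2], which is below [c_1 - c = (s - 1) / 2]. *)
Lemma core_near_crit u : `|u| <= (s - 1) ^+ 2 / 2 -> core (c + u).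
Proof.
rewrite ler_norml coreE /crit => /andP[u1 u2].
have : 0 <= (s - 1) * (2 - s) by rewrite mulr_ge0 // subr_ge0 ltW.
by move=> h; apply/andP; split; lra.
Qed.

Lemma core_tent x : core x -> core (T x).
Proof.
rewrite !coreE tentE // /crit => /andP[x1 x2].
have h1 : 0 <= s * (s / 2 - x) by rewrite mulr_ge0 ?(ltW s0) // subr_ge0.
have h2 : 0 <= s * (2 - s) by rewrite mulr_ge0 ?(ltW s0) // subr_ge0 ltW.
have h3 : 0 <= (s - 1) * x by rewrite mulr_ge0 ?subr_ge0 ?(ltW s1) //; lra.
have h4 : 0 <= s * `|x - 2^-1| by rewrite mulr_ge0 // ltW.
apply/andP; split; first by case: (ger0P (x - 2^-1)) => h; lra.
lra.
Qed.

Lemma core_iter_tent n x : core x -> core (iter n T x).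
Proof. by move=> cx; elim: n => [//|n IHn]; exact: core_tent. Qed.

(* The inverse of the right branch of [T], which maps the core onto itself. *)
Definition right_inv (x : R) : R := 1 - x / s.

Lemma core_right_inv x : core x -> core (right_inv x).
Proof.
have E : x = s * (x / s) by field; rewrite gt_eqF.
rewrite !coreE /right_inv; move: (x / s) E => y -> /andP[x1 x2].
move: x1 x2; rewrite ler_pM2l // => x1 x2.
have y2 : y <= 2^-1 by rewrite -(ler_pM2l s0).
have h1 : 0 <= (s - 1) ^+ 2 by exact: sqr_ge0.
by apply/andP; split; nra.
Qed.

Lemma tent_right_inv x : core x -> T (right_inv x) = x.
Proof.
have E : x = s * (x / s) by field; rewrite gt_eqF.
rewrite coreE /right_inv tentE // /crit.
move: (x / s) E => y -> /andP[x1 x2].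
have y2 : y <= 2^-1 by rewrite -(ler_pM2l s0).
by rewrite ger0_norm; [field | lra].
Qed.

(* The point of the inverse limit with [N]-th coordinate [y] whose further
   coordinates are all obtained by the right inverse branch. *)
Definition pullback (N : nat) (y : R) : seq_space R :=
  fun j => iter (N - j) T (iter (j - N) right_inv y).

Lemma pullback_leq N y j : (j <= N)%N -> pullback N y j = iter (N - j) T y.
Proof. by rewrite /pullback -subn_eq0 => /eqP ->. Qed.

Lemma core_pullback N y : core y -> X0 (pullback N y).
Proof.
move=> cy j.
have cr n : core (iter n right_inv y).
  by elim: n => [//|n IHn]; exact: core_right_inv.
split; first by apply: core_iter_tent; exact: cr.
rewrite /pullback; have [jN|Nj] := ltnP j N.
  have -> : (N - j = (N - j.+1).+1)%N by lia.
  have -> : (j.+1 - N = 0)%N by lia.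
  by have -> : (j - N = 0)%N by lia.
have -> : (N - j.+1 = 0)%N by lia.
have -> : (N - j = 0)%N by lia.
by rewrite subSn //= tent_right_inv.
Qed.

(** Each [T] expands by at most [s] and is applied at most [N] times, while [right_inv]
    contracts. *)
Lemma pullback_dist N x y j :
  `|pullback N x j - pullback N y j| <= s ^+ N * `|x - y|.
Proof.
apply: le_trans (iter_tent_dist s1 _ _ _) _.
apply: ler_pM => //; first exact: ltW.
  by rewrite ler_eXn2l // leq_subr.
elim: (j - N)%N => [//|n IHn]; apply: le_trans IHn.
rewrite !iterS; move: (iter n _ x) (iter n _ y) => a b.
have -> : right_inv a - right_inv b = (b - a) / s by rewrite /right_inv; ring.
rewrite normrM distrC (gtr0_norm (x := s^-1)) ?invr_gt0 //.
by rewrite ler_piMr // invf_le1 // ltW.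
Qed.

Lemma dist_cvg (L : Type) (F : set_system L) (p : L -> R) (x k : R)
    (f : R -> R) {FF : Filter F} :
  (forall a b, `|f a - f b| <= k * `|a - b|) -> p @ F --> x ->
  (f \o p) @ F --> f x.
Proof.
move=> fk px; apply/cvgrPdist_lt => e e0.
have k0 : 0 < `|k| + 1 by rewrite ltr_wpDl.
move/cvgrPdist_lt : px => /(_ (e / (`|k| + 1))).
rewrite divr_gt0 // => /(_ isT); apply: filterS => l pl.
apply: le_lt_trans (fk _ _) _.
move: pl; rewrite ltr_pdivlMr //; apply: le_lt_trans.
by rewrite mulrC ler_wpM2l // (le_trans (ler_norm _)) // lerDl.
Qed.

Lemma pullback_continuous N : continuous (pullback N).
Proof.
move=> x; apply: prod_cvgP => j.
apply: (@dist_cvg _ (nbhs x) id x (s ^+ N) (fun y => pullback N y j) _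
  (fun a b => pullback_dist N a b j)); exact: cvg_id.
Qed.

Lemma tent_cvg (L : Type) (F : set_system L) (p : L -> R) (x : R)
    {FF : Filter F} :
  p @ F --> x -> (T \o p) @ F --> T x.
Proof. by apply: dist_cvg => a b; exact: tent_dist. Qed.

Lemma inverse_limit_ultra_cvg (L : Type) (F : set_system L)
    (p : L -> seq_space R) {FU : UltraFilter F} :
  (forall l, X0 (p l)) -> exists2 x, X0 x & p @ F --> x.
Proof.
move=> Xp.
have [|x Kx px] := @ultra_cvg (seq_space R) _ L F p _
  (@tychonoff nat (fun=> R) (fun=> core) (fun=> @segment_compact R _ _)).
  by move=> l j; have [] := Xp l j.
exists x => // j; split; first exact: Kx.
have pj i : (fun l => p l i) @ F --> x i by exact: coordinate_cvg px.
have Tpj : (fun l => p l j) @ F --> T (x j.+1).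
  have -> : (fun l => p l j) = T \o (fun l => p l j.+1).
    by apply/funext => l /=; have [_ ->] := Xp l j.
  exact: tent_cvg (pj j.+1).
exact: (cvg_unique (@Rhausdorff R) Tpj (pj j)).
Qed.

End InverseLimit.

(** * Criteria for not being an endpoint and for being a folding point *)

Section FoldingAndEndpoints.
Variables (R : realType) (s : R).
Hypotheses (s1 : 1 < s) (s2 : s < 2).

Local Notation c := (crit R).
Local Notation X0 := (core_inverse_limit s).

Let s0 : 0 < s. Proof. by apply: lt_trans s1. Qed.

Let sX0 n : 0 < s ^+ n. Proof. by rewrite exprn_gt0. Qed.

(** The two halves of the arc are subcontinua through [a 0]. Coordinate 0 makes [a] injective, so
    neither half contains the other. *)
Lemma arc_not_endpoint (a : R -> seq_space R) (e : R) : 0 < e ->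
  (forall t, `|t| <= e -> X0 (a t)) ->
  (forall t u j, `|t| <= e -> `|u| <= e ->
    `|a t j - a u j| = `|t - u| / s ^+ j) ->
  ~ endpoints X0 (a 0).
Proof.
move=> e0 Xa da [_ ends].
have half p q : - e <= p -> q <= e -> p <= q -> subcontinuum X0 (a @` `[p, q]).
  move=> ep qe pq.
  have small t : t \in `[p, q] -> `|t| <= e.
    by rewrite in_itv /= ler_norml => /andP[? ?]; apply/andP; split; lra.
  have ca : {within `[p, q], continuous a}.
    apply/subspace_continuousP => t tpq; apply: prod_cvgP => j.
    apply/cvgrPdist_lt => r r0.
    have rs : 0 < r * s ^+ j by rewrite mulr_gt0.
    suff : nbhs t [set u | `[p, q]%classic u -> `|a t j - a u j| < r] by [].
    apply: filterS (nbhsx_ballx t _ rs) => u tu upq.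
    by rewrite da ?small // ltr_pdivrMr.
  split.
  - by move=> _ [t tpq <-]; apply: Xa; exact: small.
  - by exists (a p), p => //=; rewrite in_itv /= lexx.
  - by apply: continuous_compact => //; exact: segment_compact.
  - by apply: connected_continuous_connected => //; exact: segment_connected.
have inj t u : `|t| <= e -> `|u| <= e -> a t = a u -> t = u.
  move=> te ue E; have := da t u 0%N te ue; rewrite E subrr normr0 expr0 divr1.
  by move/esym/eqP; rewrite normr_eq0 subr_eq0 => /eqP.
have ee : `|e| <= e by rewrite ger0_norm // ltW.
have eN : `|- e| <= e by rewrite normrN.
have [||||sub|sub] := ends (a @` `[0, e]) (a @` `[- e, 0]).
- by apply: half; rewrite ?oppr_le0 // ltW.
- by apply: half; rewrite ?oppr_le0 // ltW.
- by exists 0 => //=; rewrite in_itv /= lexx ltW.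
- by exists 0 => //=; rewrite in_itv /= lexx oppr_le0 ltW.
- have [|t /=] := sub (a e).
    by exists e => //=; rewrite in_itv /= lexx ltW.
  rewrite in_itv /= => /andP[t1 t2] /inj tE.
  have := tE _ ee; rewrite ler_norml t1 (le_trans t2 (ltW e0)) => /(_ isT).
  by lra.
- have [|t /=] := sub (a (- e)).
    by exists (- e) => //=; rewrite in_itv /= lexx oppr_le0 ltW.
  rewrite in_itv /= => /andP[t1 t2] /inj tE.
  by have := tE _ eN; rewrite ger0_norm // t2 => /(_ isT); lra.
Qed.

Lemma connected_cantor_const (A : set cantor_space) p q :
  connected A -> A p -> A q -> p = q.
Proof.
move=> cA Ap Aq; have [_ _ _ zd] := cantor_like_cantor_space.
have /= := zero_dimension_totally_disconnected zd (x := p) I.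
by move=> /seteqP[/(_ q) + _]; move=> ->//; exists A.
Qed.

(* The fold at [pullback N c] has two branches [u >= 0] and [u <= 0]; their
   points with opposite parameters agree in all coordinates below [N], hence
   have the same limit.  In a product of a Cantor set and an interval, the fold
   lies in one fibre and its middle point lies between its two end points, so
   it has the same limit as well. *)
Lemma fold_limit_folding (U : set_system nat) (N : nat -> nat)
    (x : seq_space R) (d : R) {UU : UltraFilter U} :
  0 < d -> (forall j w, 0 <= w -> s ^+ j * w <= d -> unfolded s j w) ->
  (forall j, \forall l \near U, (j < N l)%N) ->
  X0 x -> (fun l => pullback s (N l) c) @ U --> x ->
  folding_points R X0 x.
Proof.
move=> d0 dP NU Xx yx; split => // -[N0 [N0X nN0 [f [g [bij _ cf _]]]]].
have [k [e e0 ball_sub]] := nbhs_seq_space nN0.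
(* The three bounds make both branches of the fold affine, keep the fold inside [N0], and keep its
   parameters inside the core. The branches get half-width [w l] such that their length in
   coordinate 0 is exactly [r] for every [l]. *)
pose r := Num.min (Num.min d (e / 4)) ((s - 1) ^+ 2 / 2).
have r0 : 0 < r.
  rewrite !lt_min d0 !divr_gt0 // exprn_even_gt0 //= subr_eq0.
  by rewrite gt_eqF.
have rd : r <= d by rewrite !ge_min lexx.
have re : r <= e / 4 by rewrite !ge_min lexx orbT.
have rc : r <= (s - 1) ^+ 2 / 2 by rewrite !ge_min lexx orbT.
pose w l := r / s ^+ N l.
have w0 l : 0 < w l by rewrite divr_gt0.
have wr l : w l <= r.
  by rewrite ler_pdivrMr // ler_peMr ?(ltW r0) // exprn_ege1 // ltW.
have sw l : s ^+ N l * w l = r by rewrite mulrC divfK ?gt_eqF.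
pose E l u := pullback s (N l) (c + u).
have XE l u : `|u| <= w l -> X0 (E l u).
  move=> uw; apply: core_pullback => //; apply: core_near_crit => //.
  by apply: le_trans rc; apply: le_trans (wr l).
have E0 l : E l 0 = pullback s (N l) c by rewrite /E addr0.
have wn l : `|w l| <= w l by rewrite gtr0_norm.
have [z Xz Ez] := inverse_limit_ultra_cvg s1
  (fun l => XE l _ (wn l)).
have EzN : (fun l => E l (- w l)) @ U --> z.
  apply: prod_cvgP => j; apply: cvg_near_eq (coordinate_cvg (j := j) Ez).
  apply: filterS (NU j) => l jN.
  rewrite /E !pullback_leq ?(ltnW jN) //; apply/esym/iter_tentN => //.
  by rewrite subn_gt0.
have near_coord (p : nat -> seq_space R) (y : seq_space R) j (h : R) : 0 < h ->
    p @ U --> y -> \forall l \near U, `|p l j - y j| < h.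
  move=> h0 py.
  have /cvgrPdist_lt/(_ h h0) : (fun l => p l j) @ U --> y j.
    exact: coordinate_cvg py.
  by apply: filterS => l; rewrite distrC.
have E0x : (fun l => E l 0) @ U --> x by under eq_fun do rewrite E0.
have Edist l u j : `|u| <= w l -> `|E l u j - E l 0 j| <= r.
  move=> uw; apply: le_trans (pullback_dist s1 _ _ _ _) _.
  by rewrite -(sw l) ler_wpM2l ?(ltW (sX0 _)) // addr0 addrC addKr.
have e4 : 0 < e / 4 by rewrite divr_gt0.
have close :
    \forall l \near U, forall j, (j <= k)%N -> `|E l 0 j - x j| < e / 4.
  apply: (@near_leq _ U (fun j l => `|E l 0 j - x j| < e / 4)) => j.
  exact: (near_coord (fun l => E l 0) x j _ e4 E0x).
have inN l u : (forall j, (j <= k)%N -> `|E l 0 j - x j| < e / 4) ->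
    `|u| <= w l -> N0 (E l u).
  move=> lx uw; apply: ball_sub; last exact: XE.
  move=> j jk; have := Edist l u j uw; have := lx j jk => h1 h2.
  apply: le_lt_trans (ler_distD (E l 0 j) _ _) _.
  by lra.
have N0x : N0 x by apply: ball_sub => // j _; rewrite subrr normr0.
have N0z : N0 z.
  apply: ball_sub => // j jk.
  have [l [/(_ j jk) h1 h2]] :=
    filter_ex (filterI close (near_coord _ _ j _ e4 Ez)).
  have := Edist l (w l) j (wn l).
  move: h1 h2 re; rewrite !ltr_norml !ler_norml.
  move=> /andP[? ?] /andP[? ?] ? /andP[? ?]; apply/andP; split; lra.
have w0' l : `|0 : R| <= w l by rewrite normr0 ltW.
have wN' l : `|- w l| <= w l by rewrite normrN.
have fx : (fun l => f (E l 0)) @ U --> f x.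
  apply: (within_cvg (p := fun l => E l 0)) cf N0x _ E0x.
  by apply: filterS close => l lx; exact: inN.
have fz : (fun l => f (E l (w l))) @ U --> f z.
  apply: (within_cvg (p := fun l => E l (w l))) cf N0z _ Ez.
  by apply: filterS close => l lx; exact: inN.
have fzN : (fun l => f (E l (- w l))) @ U --> f z.
  apply: (within_cvg (p := fun l => E l (- w l))) cf N0z _ EzN.
  by apply: filterS close => l lx; exact: inN.
have fE l : (forall j, (j <= k)%N -> `|E l 0 j - x j| < e / 4) ->
  (f (E l (w l))).1 = (f (E l 0)).1 /\
  ((f (E l 0)).2 - (f (E l (w l))).2) *
    ((f (E l 0)).2 - (f (E l (- w l))).2) <= 0.
  move=> lx; set I := `[- w l, w l].
  have Iw u : u \in I -> `|u| <= w l by rewrite in_itv /= ler_norml.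
  have I0 : 0 \in I by rewrite in_itv /= oppr_le0 ltW.
  have Ip : w l \in I by rewrite in_itv /= lexx ge0_cp // ltW.
  have In : - w l \in I by rewrite in_itv /= lexx ge0_cp // ltW.
  have cE : {within [set` I], continuous (fun u => f (E l u))}.
    apply/subspace_continuousP => u uI.
    apply: (within_cvg (p := E l)) cf _ _ _; first exact/inN/Iw.
      apply: filterS (withinT _ _) => v vI; exact/inN/Iw.
    apply: cvg_within_filter.
    apply: (@continuous_comp _ _ _ (fun v => c + v) (pullback s (N l))).
      by apply: cvgD; [exact: cvg_cst | exact: cvg_id].
    exact: pullback_continuous.
  have cE1 : {within [set` I], continuous (fun u => (f (E l u)).1)}.
    by move=> u; apply: cvg_comp (cE u) _; exact: cvg_fst.
  have cE2 : {within [set` I], continuous (fun u => (f (E l u)).2)}.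
    by move=> u; apply: cvg_comp (cE u) _; exact: cvg_snd.
  have fst_const u v : u \in I -> v \in I -> (f (E l u)).1 = (f (E l v)).1.
    move=> uI vI; apply: (connected_cantor_const
      (connected_continuous_connected (@segment_connected _ _ _) cE1)).
      by exists u.
    by exists v.
  split; first exact: fst_const.
  (* The first component being constant, the second inherits injectivity from [f] and from
     coordinate [N l], which is [c + u]. *)
  have injE : {in I &, injective (fun u => (f (E l u)).2)}.
    move=> u v uI vI /= E2.
    have fEE : f (E l u) = f (E l v).
      by apply/eqP; rewrite eqE /= E2 (fst_const u v) // !eqxx.
    have [_ finj _] := bij.
    have EE : E l u = E l v.
      by apply: finj; rewrite ?inE //; apply/inN/Iw.
    have := congr1 (fun y : seq_space R => y (N l)) EE.
    by rewrite /E !pullback_leq // subnn /= => /addrI.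
  have wn0 : - w l < 0 by rewrite oppr_lt0.
  have [mono|mono] := itv_continuous_inj_mono cE2 injE.
    have /= h1 := mono _ _ In I0 wn0; have /= h2 := mono _ _ I0 Ip (w0 l).
    by apply: mulr_le0_ge0; rewrite ?subr_le0 ?subr_ge0 ltW.
  have /= h1 := mono _ _ I0 In wn0; have /= h2 := mono _ _ Ip I0 (w0 l).
  by apply: mulr_ge0_le0; rewrite ?subr_le0 ?subr_ge0 ltW.
have f1 : (f x).1 = (f z).1.
  have [_ _ hc _] := cantor_like_cantor_space.
  apply: (cvg_unique hc (F := (fun l => (f (E l 0)).1) @ U)).
    by apply: cvg_comp fx _; exact: cvg_fst.
  apply: cvg_near_eq (cvg_comp _ _ fz cvg_fst).
  by apply: filterS close => l /fE[].
have f2 : (f x).2 = (f z).2.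
  have fx2 : (fun l => (f (E l 0)).2) @ U --> (f x).2.
    by apply: cvg_comp fx _; exact: cvg_snd.
  have fz2 : (fun l => (f (E l (w l))).2) @ U --> (f z).2.
    by apply: cvg_comp fz _; exact: cvg_snd.
  have fzN2 : (fun l => (f (E l (- w l))).2) @ U --> (f z).2.
    by apply: cvg_comp fzN _; exact: cvg_snd.
  apply/eqP; rewrite -subr_eq0 -normr_eq0; apply: contraT => h.
  (* With all errors below a third of the distance, both end points would lie on the same side of
     the middle point. *)
  have h0 : 0 < `|(f x).2 - (f z).2| / 3.
    by rewrite divr_gt0 // lt_neqAle eq_sym h /=.
  move/cvgrPdist_lt : fx2 => /(_ _ h0) fx2.
  move/cvgrPdist_lt : fz2 => /(_ _ h0) fz2.
  move/cvgrPdist_lt : fzN2 => /(_ _ h0) fzN2.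
  have [l [[/fE[_]]]] :=
    filter_ex (filterI (filterI close fx2) (filterI fz2 fzN2)).
  rewrite /=; move: ((f x).2) ((f z).2) ((f _).2) ((f _).2) ((f _).2).
  move=> a b p q t pqt h1 [h2 h3].
  have : 0 < (t - q) * (t - p); last by rewrite ltNge pqt.
  move: h1 h2 h3; rewrite !ltr_norml.
  case: (ger0P (a - b)) => ab /andP[? ?] /andP[? ?] /andP[? ?].
    by apply: mulr_gt0; lra.
  by rewrite nmulr_rgt0; lra.
have zx : z = x.
  have [_ finj _] := bij; apply: finj; rewrite ?inE //.
  by apply/eqP; rewrite eqE /= f1 f2 !eqxx.
(* The contradiction: a common limit brings end and middle together in coordinate 0, where their
   distance is always [r]. *)
have : \forall l \near U, `|E l (w l) 0%N - E l 0 0%N| < r.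
  have h0 : 0 < r / 2 by rewrite divr_gt0.
  apply: filterS2 (near_coord _ _ 0%N _ h0 Ez) (near_coord _ _ 0%N _ h0 E0x).
  move=> l; rewrite zx !ltr_norml => /andP[? ?] /andP[? ?].
  by apply/andP; split; lra.
move=> close0; have [l [Nl]] := filter_ex (filterI (NU 0%N) close0).
rewrite /E !pullback_leq // subn0 (unfolded_dist s1 (w := w l)) //.
- by rewrite subr0 gtr0_norm // sw ltxx.
- by apply: dP; [exact: ltW | rewrite sw].
- by rewrite lexx ltW.
- by rewrite lexx ltW.
Qed.

End FoldingAndEndpoints.

(** * Close returns of the critical orbit and the resulting point *)

Section CriticalReturns.
Variables (R : realType) (s : R).
Hypotheses (s1 : 1 < s) (s2 : s < 2).

Local Notation T := (tent s).
Local Notation c := (crit R).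
Local Notation co := (crit_orbit s).
Local Notation X0 := (core_inverse_limit s).

Let s0 : 0 < s. Proof. by apply: lt_trans s1. Qed.

Let sX0 n : 0 < s ^+ n. Proof. by rewrite exprn_gt0. Qed.

Lemma exprn_unbounded (x : R) : exists i, x < s ^+ i.
Proof.
have bern i : 1 + i%:R * (s - 1) <= s ^+ i.
  elim: i => [|i IHi]; first by rewrite mul0r addr0 expr0.
  have h : s * (1 + i%:R * (s - 1)) <= s ^+ i.+1.
    by rewrite exprS ler_pM2l.
  apply: le_trans h; rewrite -natr1.
  have : 0 <= i%:R * (s - 1) ^+ 2 by rewrite mulr_ge0 ?sqr_ge0.
  lra.
have y0 : 0 <= `|x| / (s - 1) by rewrite divr_ge0 // subr_ge0 ltW.
exists (Num.bound (`|x| / (s - 1))); apply: lt_le_trans (bern _).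
have := archi_boundP y0; rewrite ltr_pdivrMr ?subr_gt0 // => h.
by apply: le_lt_trans (ler_norm x) _; lra.
Qed.

Lemma return_times (d : R) : 0 < d -> recurrent_crit s -> ~ periodic_crit s ->
  forall l, exists (ni : nat * nat) (a : R),
    [/\ (l <= ni.2)%N, (0 < ni.1)%N, 0 < a
      & co ni.1 = c + a \/ co ni.1 = c - a] /\
    [/\ d / 4 <= s ^+ ni.2 * a, s ^+ ni.2 * a <= d / 2
      & 2 * a <= (s - 1) ^+ 2 / 2].
Proof.
move=> d0 hrec hnper l.
(* The first bound forces [i > l]; the second keeps [c + 2 a] in the core. *)
pose e := Num.min (d / 4 / s ^+ l) ((s - 1) ^+ 2 / 4).
have e0 : 0 < e.
  rewrite lt_min !divr_gt0 // exprn_even_gt0 //= subr_eq0.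
  by rewrite gt_eqF.
have [_ [[n n0 <-] ne]] : (co @` [set n | (0 < n)%N]) `&` ball c e !=set0.
  apply: hrec; last exact: nbhsx_ballx.
  by exists 1%N => // n /= n0; exists n.
have : `|co n - c| < e by rewrite distrC.
move aE : `|co n - c| => a; rewrite lt_min ltr_pdivlMr // => /andP[al ac].
have a0 : 0 < a.
  rewrite -aE normr_gt0 subr_eq0; apply/eqP => h; apply: hnper.
  by exists n.
have ex : exists i, d / 4 < s ^+ i * a.
  have [i iP] := exprn_unbounded (d / 4 / a).
  by exists i; rewrite -ltr_pdivrMr.
(* By minimality, [s^i a] exceeds [d / 4] by a factor of at most [s < 2]. *)
case: (ex_minnP ex) => i iP imin.
have li : (l < i)%N.
  rewrite ltnNge; apply/negP => il.
  have : s ^+ i * a <= s ^+ l * a by rewrite ler_wpM2r ?(ltW a0) // ler_eXn2l.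
  by rewrite mulrC in al; lra.
exists (n, i), a; split; split => //=.
- exact: ltnW.
- by case: (ger0P (co n - c)) aE => _ <-; [left|right]; ring.
- exact: ltW.
- case: i iP imin li => // i _ imin _.
  have : s ^+ i * a <= d / 4.
    by rewrite leNgt; apply/negP => /imin; rewrite ltnn.
  have := mulr_gt0 (sX0 i) a0; rewrite exprS -mulrA.
  move: (s ^+ i * a) => y y0 yd.
  have : 0 < (2 - s) * y by rewrite mulr_gt0 // subr_gt0.
  by lra.
- lra.
Qed.

Lemma folding_not_endpoint (d : R) : 0 < d ->
  (forall j w, 0 <= w -> s ^+ j * w <= d -> unfolded s j w) ->
  recurrent_crit s -> ~ periodic_crit s ->
  exists2 x, folding_points R X0 x & ~ endpoints X0 x.
Proof.
move=> d0 dP hrec hnper.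
have [ni] := choice (return_times d0 hrec hnper).
move=> /choice[a aP].
pose n l := (ni l).1; pose i l := (ni l).2.
(* A single ultrafilter gives the limits for all parameters [t] at once. *)
have [U [UU ooU]] := ultraFilterLemma eventually_filter.
have iU j : \forall l \near U, (j < i l)%N.
  apply: ooU; exists j.+1 => // l /= jl.
  by have [[li _ _ _] _] := aP l; exact: leq_trans li.
pose e := d / 4; have e0 : 0 < e by rewrite divr_gt0.
(* Centred at [a l] and scaled so that [T^(i l)] becomes an isometry in [t]; the bound [e <= s^i a]
   keeps [u l t] in [[0, 2 a]]. *)
pose u l t := a l + t / s ^+ i l.
have uP l t : `|t| <= e -> 0 <= u l t <= 2 * a l.
  have [[_ _ a0 _] [da _ _]] := aP l.
  rewrite ler_norml => /andP[t1 t2].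
  have h1 : - a l <= t / s ^+ i l.
    rewrite ler_pdivlMr // mulNr mulrC; apply: le_trans t1.
    by rewrite lerN2.
  have h2 : t / s ^+ i l <= a l.
    by rewrite ler_pdivrMr // mulrC; apply: le_trans da.
  by rewrite /u; apply/andP; split; lra.
pose p t l := pullback s (i l) (c + u l t).
have XP t l : `|t| <= e -> X0 (p t l).
  move=> te; apply: core_pullback => //; apply: core_near_crit => //.
  have [_ [_ _ ac]] := aP l; have /andP[u0 u2] := uP l t te.
  by rewrite ger0_norm // (le_trans u2).
have : forall t, exists x : seq_space R,
    `|t| <= e -> X0 x /\ (fun l => p t l) @ U --> x.
  move=> t; have [te|] := boolP (`|t| <= e); last by exists (fun=> 0).
  have [x Xx px] := inverse_limit_ultra_cvg s1 (fun l => XP t l te).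
  by exists x.
move=> /choice[b bP].
(* For each [l] with [j < i l] the equality holds exactly for [p], since
   [s^(i - j) / s^i = 1 / s^j]; it then passes to the limit. *)
have db t v j : `|t| <= e -> `|v| <= e ->
    `|b t j - b v j| = `|t - v| / s ^+ j.
  move=> te ve; have [_ bt] := bP t te; have [_ bv] := bP v ve.
  have cvgD : (fun l => `|p t l j - p v l j|) @ U --> `|b t j - b v j|.
    by apply: cvg_norm; apply: cvgB; exact: coordinate_cvg.
  apply: (cvg_unique (@Rhausdorff R) cvgD).
  apply: (cvg_near_eq (p := fun=> `|t - v| / s ^+ j)); last exact: cvg_cst.
  apply: filterS (iU j) => l jl.
  have [[_ _ a0 _] [_ ad _]] := aP l.
  rewrite /p !pullback_leq ?(ltnW jl) // (unfolded_dist s1 (w := 2 * a l));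
    [|by rewrite subn_gt0| |exact: uP|exact: uP].
    have -> : u l t - u l v = (t - v) / s ^+ i l by rewrite /u; ring.
    rewrite normrM normfV (gtr0_norm (sX0 _)) -{2}(subnK (ltnW jl)) exprD.
    by field; rewrite !gt_eqF.
  apply: dP; first by rewrite mulr_ge0 // ltW.
  (* The upper bound [s^i a <= d / 2] serves here: the whole interval [[0, 2 a]] stays within the
     affine range. *)
  apply: (@le_trans _ _ (s ^+ i l * (2 * a l))); last by lra.
  by rewrite ler_wpM2r ?mulr_ge0 ?(ltW a0) // ler_eXn2l // leq_subr.
have e00 : `|0 : R| <= e by rewrite normr0 ltW.
have [Xb0 b0] := bP 0 e00.
exists (b 0); last by apply: arc_not_endpoint e0 _ db => // t /bP[].
(* The same point is a limit of histories of [c]: in coordinates [j < i l], the history of [c + a l]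
   agrees with that of [c_(n l)], by symmetry also if [c_(n l) = c - a l]. *)
apply: (@fold_limit_folding _ _ s1 s2 U (fun l => n l + i l)%N) d0 dP _ Xb0 _.
  by move=> j; apply: filterS (iU j) => l jl; rewrite ltn_addl.
apply: prod_cvgP => j; apply: cvg_near_eq (coordinate_cvg (j := j) b0).
apply: filterS (iU j) => l jl; have [[_ n0 _ co_n] _] := aP l.
have ij : (0 < i l - j)%N by rewrite subn_gt0.
rewrite /p /u mul0r addr0 !pullback_leq ?(ltnW jl) //; last first.
  by rewrite ltnW // ltn_addl.
have -> : iter (i l - j) T (c + a l) = iter (i l - j) T (co (n l)).
  by case: co_n => ->; rewrite ?iter_tentN.
rewrite crit_orbitD /crit_orbit; congr (iter _ _ _).
by rewrite addnC addnBA // ltnW.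
Qed.

End CriticalReturns.

Theorem corollary6p3 (R : realType) (s : R) (Q : nat -> nat)
    (hs1 : Num.sqrt 2 < s) (hs2 : s < 2)
    (hQ : kneading_map s Q)
    (hQbounded : exists B : nat, forall k : nat, (1 <= k)%N -> (Q k <= B)%N)
    (hrec : recurrent_crit s) (hnper : ~ periodic_crit s) :
  folding_points R (core_inverse_limit s) <> endpoints (core_inverse_limit s).
Proof.
have s1 : 1 < s.
  by apply: le_lt_trans hs1; rewrite -[leLHS]sqrtr1 ler_sqrt // ler1n.
have [d d0 dP] := unfolded_small s1 hs2 hQ hQbounded hnper.
have [x Fx Ex] := folding_not_endpoint s1 hs2 d0 dP hrec hnper.
by move=> FE; apply: Ex; rewrite -FE.
Qed.
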